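(* Let $T:D(T)\subset \ell^2(\mathbb{Z}_{\ge 0})\to \ell^2(\mathbb{Z}_{\ge 0})$ be a tridiagonal operator with coefficients $\{l_n\}_{n\ge 0},\{d_n\}_{n\ge 0},\{u_n\}_{n\ge 0}$. If $l_nu_n\neq 0$ for all $n\ge 0$, then for all $m\ge 0$, $\langle e_0,T^me_0\rangle$ is the $m$th moment $f(x^m)$ of the moment functional $f$, normalized by $f(1)=1$, associated to the orthogonal polynomial sequence $\{p_n(x)\}_{n\ge 0}$ given by $$p_0(x)=1,\quad p_1(x)=x-b_0,\quad p_{n+1}(x)=(x-b_n)p_n(x)-\lambda_np_{n-1}(x)\ \ (n\ge 1),$$ where $b_n=d_n$ and $\lambda_n=l_{n-1}u_{n-1}$.
   Context: $\ell^2(\mathbb{Z}_{\ge 0})$ is the complex Hilbert space with orthonormal basis $e_0,e_1,e_2,\ldots$. A tridiagonal operator is a linear operator $T:D(T)\subset \ell^2(\mathbb{Z}_{\ge 0})\to\ell^2(\mathbb{Z}_{\ge 0})$, defined on at least the linear span of $\{e_0,e_1,\ldots\}$, for which there are real numbers $\{l_n\}_{n\ge 0},\{d_n\}_{n\ge 0},\{u_n\}_{n\ge 0}$ with $Te_0=d_0e_0+l_0e_1$ and $Te_n=u_{n-1}e_{n-1}+d_ne_n+l_ne_{n+1}$ for $n\ge 1$. A sequence of polynomials $\{p_n(x)\}_{n\ge 0}$ with $\deg p_n=n$ is an orthogonal polynomial sequence with moment functional $f$ if $f:\mathbb{C}[x]\to\mathbb{C}$ is a linear form such that $f(p_m(x)p_n(x))=0$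 for $m\ne n$ and $f(p_n(x)^2)\ne 0$ for all $n$; the functional $f$ is determined by the sequence up to a nonzero constant factor. *)

(* Defs.v *)
From HB Require Import structures.
From mathcomp Require Import all_boot all_order all_algebra.
From mathcomp Require Import ring complex.
From mathcomp Require Import all_classical all_reals all_analysis.

Set Implicit Arguments.
Unset Strict Implicit.
Unset Printing Implicit Defensive.

Import Order.TTheory GRing.Theory Num.Theory.
Import numFieldNormedType.Exports.

Local Open Scope classical_set_scope.
Local Open Scope ring_scope.
Local Open Scope complex_scope.

Section SquareSummable.
Variable R : realType.
Implicit Types x y : nat -> R[i].

Definition square_summable : {pred nat -> R[i]} :=
  [pred x | `[< cvgn (series (fun n => ComplexField.Normc.normc (x n) ^+ 2)) >]].

Let normc_ge0 (z : R[i]) : 0 <= ComplexField.Normc.normc z.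
Proof. by case: z => ? ?; exact: sqrtr_ge0. Qed.

Lemma square_summableP x :
  reflect (cvgn (series (fun n => ComplexField.Normc.normc (x n) ^+ 2)))
          (x \in square_summable).
Proof. exact: asboolP. Qed.

Lemma square_summable_submod : submod_closed square_summable.
Proof.
split.
  apply/square_summableP; rewrite [X in series X](_ : _ = fun=> 0).
    by rewrite /series /=; under eq_fun do rewrite big1//; exact: is_cvg_cst.
  by apply/funext => n; rewrite ComplexField.Normc.normc0 expr0n.
move=> a x y /square_summableP cx /square_summableP cy.
apply/square_summableP.
apply: (@series_le_cvg _ _ (fun n =>
  2 * ComplexField.Normc.normc a ^+ 2 * ComplexField.Normc.normc (x n) ^+ 2 +
  2 * ComplexField.Normc.normc (y n) ^+ 2)).
- by move=> n; exact: sqr_ge0.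
- by move=> n; rewrite addr_ge0 ?mulr_ge0 ?sqr_ge0.
- move=> n /=.
  have sqr_le_sum (s t : R) : (s + t) ^+ 2 <= 2 * s ^+ 2 + 2 * t ^+ 2.
    rewrite -subr_ge0 (_ : _ - _ = (s - t) ^+ 2) ?sqr_ge0//; ring.
  rewrite -mulrA -exprMn -ComplexField.Normc.normcM.
  apply: le_trans (sqr_le_sum _ _); rewrite ler_pXn2r ?nnegrE ?addr_ge0 ?normc_ge0//.
  exact: le_normcD.
- rewrite (_ : series _ =
    (2 * ComplexField.Normc.normc a ^+ 2) *:
      series (fun n => ComplexField.Normc.normc (x n) ^+ 2) +
    2 *: series (fun n => ComplexField.Normc.normc (y n) ^+ 2)); last first.
    apply/funext => n; rewrite /series /= !fctE /= big_split /=.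
    by rewrite -!mulr_sumr.
  by apply: is_cvgD; exact: is_cvgZr.
Qed.

HB.instance Definition _ :=
  GRing.isSubmodClosed.Build R[i] (nat -> R[i]) square_summable
    square_summable_submod.

Record l2 := L2 { l2val :> nat -> R[i]; _ : l2val \in square_summable }.

HB.instance Definition _ := [isSub for l2val].
HB.instance Definition _ := [Choice of l2 by <:].
HB.instance Definition _ := [SubChoice_isSubLmodule of l2 by <:].

End SquareSummable.

Section Hilbert.
Variable R : realType.

(* Conjugate-linear in the first argument; the series converges for all
   square-summable x and y by the Cauchy-Schwarz inequality, so that limn is
   never applied to a divergent sequence. *)
Definition inner (x y : l2 R) : R[i] :=
  limn (series (fun n => (x n)^* * y n) : nat -> R[i]^o).

Definition basis_fun (n : nat) : nat -> R[i] := fun k => (k == n)%:R.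

Lemma basis_funP n : basis_fun n \in @square_summable R.
Proof.
apply/square_summableP; apply: (cvgP (1 : R)); apply: cvg_near_cst.
exists n.+1 => // k /= nk; rewrite /series /= big_mkord.
rewrite (bigD1 (Ordinal nk))//= /basis_fun eqxx ComplexField.Normc.normc1.
rewrite expr1n big1 ?addr0// => i /negPf; rewrite -val_eqE /= => ->.
by rewrite ComplexField.Normc.normc0 expr0n.
Qed.

Definition e_ n : l2 R := L2 (basis_funP n).

Lemma inner_e n x : inner (e_ n) x = x n.
Proof.
apply: (@lim_near_cst (R[i]^o)); first exact: norm_hausdorff.
exists n.+1 => // k /= nk; rewrite /series /= big_mkord.
rewrite (bigD1 (Ordinal nk))//= /basis_fun eqxx rmorph1 mul1r big1 ?addr0//.
by move=> i /negPf; rewrite -val_eqE /= => ->; rewrite rmorph0 mul0r.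
Qed.

(* A linear operator defined on a linear subspace of l2; the values of the
   underlying total function outside of the domain are irrelevant. *)
Record partial_op := PartialOp {
  dom : set (l2 R);
  op :> l2 R -> l2 R;
  dom0 : dom 0;
  domP : forall (a : R[i]) x y, dom x -> dom y -> dom (a *: x + y);
  op_linear : forall (a : R[i]) x y, dom x -> dom y ->
    op (a *: x + y) = a *: op x + op y }.

Definition dom_pow (T : partial_op) (m : nat) : set (l2 R) :=
  [set x | forall k, (k < m)%N -> dom T (iter k T x)].

Definition tridiagonal (T : partial_op) (l d u : nat -> R) : Prop :=
  [/\ forall (N : nat) (c : nat -> R[i]), dom T (\sum_(n < N) c n *: e_ n),
      T (e_ 0%N) = (d 0%N)%:C *: e_ 0%N + (l 0%N)%:C *: e_ 1%N
    & forall n, (1 <= n)%N ->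
        T (e_ n) = (u n.-1)%:C *: e_ n.-1 + (d n)%:C *: e_ n
                   + (l n)%:C *: e_ n.+1].

End Hilbert.

Arguments e_ {R}.

Definition is_OPS (K : fieldType) (p : nat -> {poly K}) (f : {scalar {poly K}})
    : Prop :=
  [/\ forall n, size (p n) = n.+1,
      forall m n, m <> n -> f (p m * p n) = 0
    & forall n, f (p n ^+ 2) <> 0].

(* Main.v *)
Require Import Defs.
From HB Require Import structures.
From mathcomp Require Import all_boot all_order all_algebra.
From mathcomp Require Import complex.
From mathcomp Require Import all_classical all_reals all_analysis.
From mathcomp Require Import ring.

(** The functional is f(q) = <e_0, q(T) e_0>.  Two dual identities show that it
    is orthogonalizing.  The recurrence gives
      p_n(T) e_0 = (l_0 ... l_(n-1)) e_n,
    and, reading the same recurrence along the rows of T instead of its columns,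
      <e_0, p_m(T) x> = (u_0 ... u_(m-1)) <e_m, x>
    for every finitely supported x (below, x = q(T) e_0).  Together they yield
      f(p_m p_n) = (u_0 ... u_(m-1)) (l_0 ... l_(n-1)) <e_m, e_n>,
    which vanishes for m <> n and is nonzero for m = n since l_k u_k <> 0.
    Orthogonality against p_0 = 1 prescribes the value of any orthogonalizing
    functional on every p_n, and the p_n span the polynomials by degree, which
    gives uniqueness.  The argument stays within finitely supported vectors, so
    the only analytic fact it uses is that <e_n, x> is the n-th coordinate
    of x. *)

Set Implicit Arguments.
Unset Strict Implicit.
Unset Printing Implicit Defensive.

Import Order.TTheory GRing.Theory Num.Theory.
Import numFieldNormedType.Exports.

Local Open Scope classical_set_scope.
Local Open Scope ring_scope.
Local Open Scope complex_scope.

(** * Polynomial sequences of exact degree *)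

Section PolynomialSequences.
Variable K : fieldType.
Implicit Types (p : nat -> {poly K}) (f g : {scalar {poly K}}).

(** A sequence of exact degree spans the polynomials: the leading term of a
    polynomial of degree n is cancelled by a multiple of p_n. *)
Lemma eq_scalar_graded p f g : (forall n, size (p n) = n.+1) ->
  (forall n, f (p n) = g (p n)) -> f =1 g.
Proof.
move=> sp fg q; have [n] := ubnP (size q); elim: n q => // n IHn q qn.
have [qltn|] := ltnP (size q) n; first exact: IHn.
case: n => [|n] in IHn qn * => nleq.
  by rewrite (_ : q = 0) ?raddf0//; apply/eqP; rewrite -size_poly_leq0 -ltnS.
have p_lead : (p n)`_n != 0.
  have -> : (p n)`_n = lead_coef (p n) by rewrite lead_coefE sp.
  by rewrite lead_coef_eq0 -size_poly_gt0 sp.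
pose c := q`_n / (p n)`_n.
have eq_q : q = c *: p n + (q - c *: p n) by rewrite addrC subrK.
rewrite eq_q !linearP fg (IHn (q - c *: p n))// ltnS.
apply/leq_sizeP => j; rewrite leq_eqVlt => /predU1P[<-|nj].
  by rewrite coefB coefZ divfK// subrr.
by rewrite coefB coefZ !nth_default ?mulr0 ?subr0 ?sp// (leq_trans _ nj).
Qed.

(** Orthogonality to p_0 = 1 makes f vanish on every p_n with n > 0, so that
    f 1 alone determines f. *)
Lemma is_OPS_unique p f g : p 0%N = 1 -> is_OPS p f -> is_OPS p g ->
  f 1 = g 1 -> f =1 g.
Proof.
move=> p0 [sp fO _] [_ gO _] fg1; apply: (eq_scalar_graded sp) => -[|n].
  by rewrite p0.
have := fO 0%N n.+1 (@O_S n); have := gO 0%N n.+1 (@O_S n).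
by rewrite p0 mul1r => -> ->.
Qed.

Lemma size_three_term p (b c : nat -> K) : p 0%N = 1 ->
  p 1%N = 'X - (b 0%N)%:P ->
  (forall n, (1 <= n)%N ->
    p n.+1 = ('X - (b n)%:P) * p n - c n *: p n.-1) ->
  forall n, size (p n) = n.+1.
Proof.
move=> p0 p1 pS n.
(* The recurrence has two steps, so two consecutive terms are carried. *)
suff [] : size (p n) = n.+1 /\ size (p n.+1) = n.+2 by [].
elim: n => [|n [IH0 IH1]]; first by rewrite p0 p1 size_poly1 size_XsubC.
split=> //; have sXp : size (('X - (b n.+1)%:P) * p n.+1) = n.+3.
  rewrite size_proper_mul ?size_XsubC ?IH1//.
  by rewrite lead_coefXsubC mul1r lead_coef_eq0 -size_poly_gt0 IH1.
rewrite pS// size_polyDl ?sXp// size_polyN.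
by rewrite (leq_ltn_trans (size_scale_leq _ _))// IH0.
Qed.

End PolynomialSequences.

(** * Finitely supported vectors *)

Section FiniteSupport.
Variable R : realType.
Implicit Types (x y : l2 R) (a : R[i]).

Lemma l2P x y : (forall n, x n = y n) -> x = y.
Proof. by move=> xy; apply/val_inj/funext. Qed.

Lemma l2D x y n : (x + y) n = x n + y n. Proof. by []. Qed.

Lemma l2Z a x n : (a *: x) n = a * x n. Proof. by []. Qed.

Lemma l2B x y n : (x - y) n = x n - y n. Proof. by []. Qed.

Lemma l2_sum (I : Type) (r : seq I) (F : I -> l2 R) n :
  (\sum_(i <- r) F i) n = \sum_(i <- r) F i n.
Proof. by elim/big_rec2: _ => // i y1 y2 _ <-. Qed.

Lemma e_E n k : (@e_ R n) k = (k == n)%:R. Proof. by []. Qed.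

(** Vectors with finitely many nonzero coordinates, that is, the linear span of
    the basis; stated by a bound past which the coordinates vanish. *)
Definition finsupp x := exists N, forall n, (N <= n)%N -> x n = 0.

Lemma finsupp_e n : finsupp (e_ n).
Proof. by exists n.+1 => k nk; rewrite e_E gtn_eqF. Qed.

Lemma finsupp_lin a x y : finsupp x -> finsupp y -> finsupp (a *: x + y).
Proof.
move=> [M xM] [N yN]; exists (maxn M N) => n; rewrite geq_max => /andP[Mn Nn].
by rewrite l2D l2Z xM// yN// mulr0 addr0.
Qed.

Lemma finsuppZ a x : finsupp x -> finsupp (a *: x).
Proof. by move=> [N xN]; exists N => n Nn; rewrite l2Z xN// mulr0. Qed.

Lemma finsupp_expand x N : (forall n, (N <= n)%N -> x n = 0) ->
  x = \sum_(n < N) x n *: e_ n.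
Proof.
move=> xN; apply: l2P => n; rewrite l2_sum.
under eq_bigr do rewrite l2Z e_E.
have [nN|Nn] := ltnP n N; last first.
  by rewrite xN// big1// => i _; rewrite gtn_eqF ?mulr0// (leq_trans _ Nn).
rewrite (bigD1 (Ordinal nN))//= eqxx mulr1 big1 ?addr0// => i.
by rewrite -val_eqE /= eq_sym => /negPf ->; rewrite mulr0.
Qed.

Lemma finsupp_ind (P : l2 R -> Prop) : P 0 ->
  (forall a n x, finsupp x -> P x -> P (a *: e_ n + x)) ->
  forall x, finsupp x -> P x.
Proof.
move=> P0 PS x [N] /finsupp_expand ->.
suff [] : finsupp (\sum_(n < N) x n *: e_ n) /\ P (\sum_(n < N) x n *: e_ n).
  by [].
elim: N => [|N [IHs IHP]]; first by rewrite big_ord0; split=> //; exists 0%N.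
rewrite big_ord_recr /= addrC; split; last exact: PS.
by apply: finsupp_lin => //; exact: finsupp_e.
Qed.

End FiniteSupport.

(** * Polynomials in a tridiagonal operator *)

Section Tridiagonal.
Variables (R : realType) (T : partial_op R) (l d u : nat -> R).
Hypothesis hT : tridiagonal T l d u.

Lemma tridiagonal_dom x : finsupp x -> dom T x.
Proof.
by case: hT => + _ _ => Tdom [N] /finsupp_expand ->; exact: Tdom.
Qed.

Lemma partial_op0 : T 0 = 0.
Proof.
have := @op_linear R T (-1) 0 0 (dom0 T) (dom0 T).
by rewrite scaleN1r oppr0 addr0 scaleN1r addNr.
Qed.

Lemma tridiagonal_lin a x y : finsupp x -> finsupp y ->
  T (a *: x + y) = a *: T x + T y.
Proof. by move=> fx fy; apply: op_linear; exact: tridiagonal_dom. Qed.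

Lemma tridiagonal_finsupp x : finsupp x -> finsupp (T x).
Proof.
move: x; apply: finsupp_ind; first by rewrite partial_op0; exists 0%N.
move=> a n x fx fTx; rewrite tridiagonal_lin//; last exact: finsupp_e.
apply: finsupp_lin => //; case: hT => _ Te0 TeS.
case: n => [|n]; first by rewrite Te0; apply: finsupp_lin;
  [exact: finsupp_e | apply: finsuppZ; exact: finsupp_e].
rewrite TeS// -addrA; do 2 (apply: finsupp_lin; first exact: finsupp_e).
by apply: finsuppZ; exact: finsupp_e.
Qed.

(** Row n of the matrix of T has the entries l_(n-1), d_n, u_n; row 0 lacks the
    first of them. *)
Lemma tridiagonal_coord0 x : finsupp x ->
  T x 0%N = (d 0%N)%:C * x 0%N + (u 0%N)%:C * x 1%N.
Proof.
move: x; apply: finsupp_ind; first by rewrite partial_op0 !mulr0 addr0.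
move=> a n x fx IH; rewrite tridiagonal_lin//; last exact: finsupp_e.
rewrite !l2D !l2Z IH; case: hT => _ Te0 TeS.
case: n => [|[|n]]; rewrite ?Te0 ?TeS// !l2D !l2Z !e_E /=; ring.
Qed.

Lemma tridiagonal_coordS x n : finsupp x ->
  T x n.+1 = (l n)%:C * x n + (d n.+1)%:C * x n.+1 + (u n.+1)%:C * x n.+2.
Proof.
move: x; apply: finsupp_ind; first by rewrite partial_op0 !mulr0 !addr0.
move=> a k x fx IH; rewrite tridiagonal_lin//; last exact: finsupp_e.
rewrite !l2D !l2Z IH; case: hT => _ Te0 TeS.
case: k => [|k].
  rewrite Te0 !l2D !l2Z !e_E eqSS /=.
  by case: n {IH} => [|n] /=; ring.
rewrite TeS// !l2D !l2Z !e_E /= !eqSS.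
have SF j : (j.+1 == j) = false by rewrite gtn_eqF.
have SSF j : (j.+2 == j) = false by rewrite gtn_eqF// ltnW.
(* The column k.+1 meets the row n.+1 only on the three diagonals n = k.+1,
   n = k and n.+1 = k. *)
have [->|_] := eqVneq n k.+1; first by rewrite SF SSF /=; ring.
have [->|_] := eqVneq n k; first by rewrite SF /=; ring.
by have [<-|_] := eqVneq n.+1 k; rewrite /=; ring.
Qed.

(** The vector q(T) e_0, obtained by replacing each monomial of q by the
    corresponding iterate of T at e_0. *)
Definition apply_poly (q : {poly R[i]}) : l2 R :=
  \sum_(i < size q) q`_i *: iter i T (e_ 0%N).

Lemma finsupp_iter i : finsupp (iter i T (e_ 0%N)).
Proof.
by elim: i => [|i IHi] /=; [exact: finsupp_e | exact: tridiagonal_finsupp].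
Qed.

Lemma apply_poly_widen N (q : {poly R[i]}) : (size q <= N)%N ->
  apply_poly q = \sum_(i < N) q`_i *: iter i T (e_ 0%N).
Proof.
move=> qN; rewrite /apply_poly (big_ord_widen N
  (fun i => q`_i *: iter i T (e_ 0%N)))// big_mkcond; apply: eq_bigr => i _.
by case: ifPn => //; rewrite -leqNgt => ?; rewrite nth_default// scale0r.
Qed.

Lemma apply_poly_is_linear : linear apply_poly.
Proof.
move=> a q r; pose N := maxn (size q) (size r).
have qN : (size q <= N)%N by exact: leq_maxl.
have rN : (size r <= N)%N by exact: leq_maxr.
rewrite !(@apply_poly_widen N)//; last first.
  rewrite (leq_trans (size_polyD _ _))// geq_max rN andbT.
  exact: leq_trans (size_scale_leq _ _) qN.
rewrite scaler_sumr -big_split; apply: eq_bigr => i _ /=.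
by rewrite coefD coefZ scalerDl scalerA.
Qed.

HB.instance Definition _ :=
  GRing.isLinear.Build R[i] {poly R[i]} (l2 R) _ apply_poly
    apply_poly_is_linear.

Lemma apply_polyB q r : apply_poly (q - r) = apply_poly q - apply_poly r.
Proof. exact: linearB. Qed.

Lemma apply_polyZ a q : apply_poly (a *: q) = a *: apply_poly q.
Proof. exact: linearZ. Qed.

Lemma apply_polyXn n : apply_poly 'X^n = iter n T (e_ 0%N).
Proof.
rewrite /apply_poly size_polyXn big_ord_recr /= coefXn eqxx scale1r.
by rewrite big1 ?add0r// => i _; rewrite coefXn ltn_eqF// scale0r.
Qed.

Lemma apply_poly1 : apply_poly 1 = e_ 0%N.
Proof. by rewrite -(expr0 'X) apply_polyXn. Qed.

Lemma finsupp_apply_poly q : finsupp (apply_poly q).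
Proof.
rewrite /apply_poly; elim: (size _) => [|n IHn].
  by rewrite big_ord0; exists 0%N.
by rewrite big_ord_recr /= addrC; apply: finsupp_lin => //; exact: finsupp_iter.
Qed.

Lemma apply_polyXM q : apply_poly ('X * q) = T (apply_poly q).
Proof.
rewrite mulrC; rewrite -[q in LHS]coefK -[q in RHS]coefK poly_def.
elim: (size q) => [|n IHn].
  by rewrite !big_ord0 mul0r raddf0 partial_op0.
rewrite !big_ord_recr /= mulrDl !raddfD /= -scalerAl -exprSr !linearZ /=.
rewrite !apply_polyXn IHn addrC [in RHS]addrC tridiagonal_lin//.
  exact: finsupp_iter.
exact: finsupp_apply_poly.
Qed.

Variables (b lambda : nat -> R) (p : nat -> {poly R[i]}).
Hypothesis hb : forall n, b n = d n.
Hypothesis hlambda : forall n, (1 <= n)%N -> lambda n = l n.-1 * u n.-1.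
Hypothesis hp0 : p 0%N = 1.
Hypothesis hp1 : p 1%N = 'X - (b 0%N)%:C%:P.
Hypothesis hp : forall n, (1 <= n)%N ->
  p n.+1 = ('X - (b n)%:C%:P) * p n - (lambda n)%:C *: p n.-1.

(** Scale factors of the columns and of the rows: lprod n = l_0 ... l_(n-1) and
    uprod n = u_0 ... u_(n-1). *)
Let lprod n : R[i] := \prod_(k < n) (l k)%:C.
Let uprod n : R[i] := \prod_(k < n) (u k)%:C.

Lemma three_termM n q : p n.+2 * q =
  p n.+1 * ('X * q) - (d n.+1)%:C *: (p n.+1 * q)
  - ((l n)%:C * (u n)%:C) *: (p n * q).
Proof.
rewrite hp//= hb hlambda//= rmorphM /= -!mul_polyC; ring.
Qed.

Lemma three_termM0 q : p 1%N * q = 'X * q - (d 0%N)%:C *: q.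
Proof. by rewrite hp1 hb -mul_polyC; ring. Qed.

(** The columns of T: p_n(T) e_0 is a multiple of e_n. *)
Lemma apply_poly_OPS n : apply_poly (p n) = lprod n *: e_ n.
Proof.
suff [] : apply_poly (p n) = lprod n *: e_ n /\
          apply_poly (p n.+1) = lprod n.+1 *: e_ n.+1 by [].
have lS k : lprod k.+1 = lprod k * (l k)%:C by rewrite /lprod big_ord_recr.
have l0 : lprod 0 = 1 by rewrite /lprod big_ord0.
have TZ a k : T (a *: e_ k) = a *: T (e_ k).
  rewrite -[X in T X]addr0 tridiagonal_lin ?partial_op0 ?addr0//.
    exact: finsupp_e.
  by exists 0%N.
case: hT => _ Te0 TeS; elim: n => [|n [IH0 IH1]].
  rewrite hp0 apply_poly1 lS l0 mul1r scale1r; split=> //.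
  rewrite -[p 1%N]mulr1 three_termM0 apply_polyB apply_polyZ apply_polyXM.
  by rewrite apply_poly1 Te0 addrC addKr.
split=> //; rewrite -[p n.+2]mulr1 three_termM !mulr1 [p n.+1 * 'X]mulrC.
rewrite !apply_polyB !apply_polyZ apply_polyXM IH0 IH1 TZ TeS//.
apply: l2P => k.
rewrite !(l2B, l2D, l2Z) !lS; ring.
Qed.

(** The rows of T: with x = q(T) e_0, the inner product of e_0 with p_m(T) x is
    a multiple of that of e_m with x.  The induction is on m for all q at once,
    since the recurrence replaces q by X q, that is, x by T x. *)
Lemma coord0_apply_polyM m q :
  apply_poly (p m * q) 0%N = uprod m * apply_poly q m.
Proof.
suff [] : apply_poly (p m * q) 0%N = uprod m * apply_poly q m /\
  apply_poly (p m.+1 * q) 0%N = uprod m.+1 * apply_poly q m.+1 by [].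
have uS k : uprod k.+1 = uprod k * (u k)%:C by rewrite /uprod big_ord_recr.
have u0 : uprod 0 = 1 by rewrite /uprod big_ord0.
elim: m q => [|m IH] q.
  rewrite hp0 mul1r uS u0 !mul1r; split=> //.
  rewrite three_termM0 apply_polyB apply_polyZ apply_polyXM l2B l2Z.
  by rewrite tridiagonal_coord0 1?addrC ?addKr//; exact: finsupp_apply_poly.
have [IH0 IH1] := IH q; split=> //; have [_ IHX] := IH ('X * q).
rewrite three_termM !apply_polyB !apply_polyZ !l2B !l2Z IH0 IH1 IHX.
rewrite apply_polyXM tridiagonal_coordS; last exact: finsupp_apply_poly.
by rewrite !uS; ring.
Qed.

(** The functional q |-> <e_0, q(T) e_0>. *)
Definition tridiagonal_moment (q : {poly R[i]}) : R[i] := apply_poly q 0%N.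

Lemma tridiagonal_moment_is_scalar : scalar tridiagonal_moment.
Proof. by move=> a q r; rewrite /tridiagonal_moment linearP. Qed.

HB.instance Definition _ :=
  GRing.isLinear.Build R[i] {poly R[i]} R[i] _ tridiagonal_moment
    tridiagonal_moment_is_scalar.

Lemma tridiagonal_moment_OPS m n :
  tridiagonal_moment (p m * p n) = uprod m * lprod n * (m == n)%:R.
Proof.
by rewrite /tridiagonal_moment coord0_apply_polyM apply_poly_OPS l2Z e_E mulrA.
Qed.

Lemma tridiagonal_is_OPS : (forall n, l n * u n <> 0) ->
  is_OPS p tridiagonal_moment.
Proof.
move=> hlu; split.
- exact: (@size_three_term _ p (fun n => (b n)%:C) (fun n => (lambda n)%:C)).
- by move=> m n /eqP/negPf mn; rewrite /= tridiagonal_moment_OPS mn mulr0.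
- move=> n; rewrite expr2 /= tridiagonal_moment_OPS eqxx mulr1; apply/eqP.
  rewrite /uprod /lprod -big_split /=.
  apply/prodf_neq0 => k _; rewrite -rmorphM /= mulrC.
  by rewrite (inj_eq (@complexI R)) //; apply/eqP.
Qed.

End Tridiagonal.

Theorem corollary2p6 (R : realType) (T : partial_op R) (l d u : nat -> R)
    (hT : tridiagonal T l d u)
    (hlu : forall n, l n * u n <> 0)
    (b lambda : nat -> R)
    (hb : forall n, b n = d n)
    (hlambda : forall n, (1 <= n)%N -> lambda n = l n.-1 * u n.-1)
    (p : nat -> {poly R[i]})
    (hp0 : p 0%N = 1)
    (hp1 : p 1%N = 'X - (b 0%N)%:C%:P)
    (hp : forall n, (1 <= n)%N ->
      p n.+1 = ('X - (b n)%:C%:P) * p n - (lambda n)%:C *: p n.-1) :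
  exists f : {scalar {poly R[i]}},
    [/\ is_OPS p f,
        f 1 = 1,
        forall g : {scalar {poly R[i]}}, is_OPS p g -> g 1 = 1 -> g =1 f
      & forall m : nat,
          dom_pow T m (e_ 0%N) /\ inner (e_ 0%N) (iter m T (e_ 0%N)) = f 'X^m].
Proof.
have fOPS := tridiagonal_is_OPS hT hb hlambda hp0 hp1 hp hlu.
have f1 : tridiagonal_moment T 1 = 1.
  by rewrite /tridiagonal_moment apply_poly1.
exists (tridiagonal_moment T); split=> //.
  by move=> g gOPS g1; exact: is_OPS_unique hp0 gOPS fOPS (etrans g1 (esym f1)).
move=> m; split.
  by move=> k _; apply: (tridiagonal_dom hT); exact: finsupp_iter hT k.
by rewrite inner_e /= /tridiagonal_moment apply_polyXn.
Qed.
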